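(* Let $T\in\mathcal C(H_1,H_2)$. If $T$ attains its reduced minimum (there exists $x_0\in C(T)$ with $\|x_0\|=1$ and $\|Tx_0\|=\gamma(T)$), then $T$ is minimum attaining (there exists $x_1\in D(T)$ with $\|x_1\|=1$ and $\|Tx_1\|=m(T)$).
   Context: $H_1,H_2$ are infinite dimensional complex Hilbert spaces. $\mathcal C(H_1,H_2)$ denotes the class of densely defined closed linear operators from a dense subspace $D(T)\subseteq H_1$ into $H_2$. $N(T)$ is the null space of $T$ and $C(T):=D(T)\cap N(T)^{\perp}$ is its carrier. The minimum modulus and the reduced minimum modulus are $m(T):=\inf\{\|Tx\|: x\in D(T),\ \|x\|=1\}$ and $\gamma(T):=\inf\{\|Tx\|: x\in C(T),\ \|x\|=1\}$. *)

(* Defs.v *)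
From HB Require Import structures.
From mathcomp Require Import all_boot all_order all_algebra.
From mathcomp Require Import all_classical all_reals all_analysis.
From mathcomp Require Import complex.

Set Implicit Arguments.
Unset Strict Implicit.
Unset Printing Implicit Defensive.

Import Order.TTheory GRing.Theory Num.Theory.
Import numFieldNormedType.Exports.

Local Open Scope classical_set_scope.
Local Open Scope ring_scope.
Local Open Scope complex_scope.

(* The inner product is linear in its first argument and conjugate-linear in
   its second one, see sesquilinear.v. *)
HB.mixin Record CompleteNormedModule_isHilbert (R : realType) H
    of CompleteNormedModule R[i] H := {
  inner : {dot H for (@Num.conj R[i])} ;
  inner_norm : forall x : H, inner x x = `|x| ^+ 2 }.

#[short(type="hilbertType")]
HB.structure Definition Hilbert (R : realType) :=
  {H of CompleteNormedModule_isHilbert R H & CompleteNormedModule R[i] H}.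

Section HilbertSpace.
Variables (R : realType) (H : hilbertType R).

(* In a normed module over R[i] the norm `|x| is a (nonnegative) element of
   R[i]; hnorm is the same norm, valued in R. *)
Definition hnorm (x : H) : R := complex.Re `|x|.

Definition infinite_dimensional : Prop :=
  ~ exists (n : nat) (e : 'I_n -> H),
      forall x, exists c : 'I_n -> R[i], x = \sum_(i < n) c i *: e i.

Definition orthocomplement (A : set H) : set H :=
  [set y | forall x, A x -> inner y x = 0].

End HilbertSpace.

(* The class C(H1, H2). The function underlying an operator is total, but only
   its values on dom are meaningful: every notion below restricts it to dom. *)
Record closed_operator (R : realType) (H1 H2 : hilbertType R) := ClosedOperator {
  dom : set H1 ;
  op :> H1 -> H2 ;
  dom_submod : submod_closed (mem dom) ;
  dom_dense : dense dom ;
  op_linear : forall a : R[i],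
    {in dom &, forall x y, op (a *: x + y) = a *: op x + op y} ;
  graph_closed : closed [set z : H1 * H2 | dom z.1 /\ op z.1 = z.2] }.

Section MinimumModulus.
Variables (R : realType) (H1 H2 : hilbertType R) (T : closed_operator H1 H2).

Definition null_space : set H1 := [set x | dom T x /\ T x = 0].

Definition carrier : set H1 := dom T `&` orthocomplement null_space.

(* Infima are taken in \bar R, so that the infimum over the empty set
   (e.g. the reduced minimum modulus of the zero operator) is +oo. *)
Definition min_modulus : \bar R :=
  ereal_inf [set (hnorm (T x))%:E | x in [set x | dom T x /\ hnorm x = 1]].

Definition reduced_min_modulus : \bar R :=
  ereal_inf [set (hnorm (T x))%:E | x in [set x | carrier x /\ hnorm x = 1]].

Definition minimum_attaining : Prop :=
  exists x, [/\ dom T x, hnorm x = 1 & (hnorm (T x))%:E = min_modulus].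

Definition reduced_minimum_attaining : Prop :=
  exists x, [/\ carrier x, hnorm x = 1 & (hnorm (T x))%:E = reduced_min_modulus].

End MinimumModulus.

(* Main.v *)
(* If N(T) contains a nonzero vector, its normalization attains m(T) = 0;
   otherwise C(T) = D(T), and the two moduli are infima of the same set. *)
Require Import Defs.
From mathcomp Require Import all_boot all_reals.
From mathcomp Require Import all_order all_algebra all_classical all_analysis complex.

Import Order.TTheory GRing.Theory Num.Theory.
Local Open Scope classical_set_scope.
Local Open Scope ring_scope.
Local Open Scope complex_scope.

(** The proof splits on whether [T] is injective on its domain. A nonzero null vector, once
    normalized, gives the value 0, the least that a norm can take
    ([nontrivial_null_space_minimum_attaining]). If the null space is trivial, its orthocomplement
    is all of [H1] ([trivial_null_space_carrier]), so the hypothesis becomes the conclusion. *)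

Lemma hnorm_ge0 (R : realType) (H : hilbertType R) (x : H) : 0 <= hnorm x.
Proof. by have := normr_ge0 x; rewrite lecE => /andP[]. Qed.

Lemma hnorm0 (R : realType) (H : hilbertType R) : hnorm (0 : H) = 0.
Proof. by rewrite /hnorm normr0. Qed.

Lemma hnorm_normalize {R : realType} {H : hilbertType R} {x : H} :
  x != 0 -> hnorm (`|x|^-1 *: x) = 1.
Proof.
by move=> x0; rewrite /hnorm normrZ normfV normr_id mulVf // normr_eq0.
Qed.

Section ClosedOperator.
Context {R : realType} {H1 H2 : hilbertType R}.
Implicit Type T : closed_operator H1 H2.

Lemma dom0 T : dom T 0.
Proof. by apply: set_mem; case: (dom_submod T). Qed.

Lemma op0 T : T 0 = 0.
Proof.
have d0 := mem_set (dom0 T).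
have := op_linear 1 d0 d0.
by rewrite !scale1r addr0 => /eqP; rewrite addrC -subr_eq subrr eq_sym => /eqP.
Qed.

Lemma null_spaceZ T (a : R[i]) (x : H1) :
  null_space T x -> null_space T (a *: x).
Proof.
move=> [dx Tx]; have d0 := mem_set (dom0 T).
(* Closure of [dom T] and linearity are both given for [a *: x + y]; here [y] is 0. *)
rewrite -[a *: x]addr0; split.
  by apply: set_mem; case: (dom_submod T) => _; apply; [exact: mem_set|].
by rewrite (op_linear a (mem_set dx) d0) Tx op0 scaler0 addr0.
Qed.

Lemma min_modulus_ge0 T : (0 <= min_modulus T)%E.
Proof. by apply: le_ereal_inf_tmp => _ [x _ <-]; rewrite lee_fin hnorm_ge0. Qed.

Lemma nontrivial_null_space_minimum_attaining T (x : H1) :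
  null_space T x -> x != 0 -> minimum_attaining T.
Proof.
move=> Nx x0; have [dy Ty] := null_spaceZ T `|x|^-1 x Nx.
have y1 := hnorm_normalize x0.
exists (`|x|^-1 *: x); split=> //; rewrite Ty hnorm0.
(* The infimum is nonnegative, and at most 0 since the unit null vector contributes the value 0. *)
apply/eqP; rewrite eq_le min_modulus_ge0 /=; apply: ereal_inf_lbound.
by exists (`|x|^-1 *: x); rewrite ?Ty ?hnorm0.
Qed.

Lemma trivial_null_space_carrier T :
  null_space T `<=` [set 0] -> carrier T = dom T.
Proof.
move=> N0; apply/seteqP; split=> [x []//|x dx]; split=> // z /N0 ->.
by rewrite linear0r.
Qed.

End ClosedOperator.

Theorem proposition3p15 (R : realType) (H1 H2 : hilbertType R)
    (H1_infdim : infinite_dimensional H1) (H2_infdim : infinite_dimensional H2)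
    (T : closed_operator H1 H2) :
  reduced_minimum_attaining T -> minimum_attaining T.
Proof.
have [[x [Nx x0]] _|N0] := pselect (exists x, null_space T x /\ x != 0).
  exact: nontrivial_null_space_minimum_attaining Nx x0.
have NT : null_space T `<=` [set 0].
  by move=> x Nx; apply/eqP/negPn/negP => x0; apply: N0; exists x.
(* Unfolding exposes [carrier T] both in the constraint on the minimizer and in the infimum;
   replacing it by [dom T] yields [minimum_attaining T] up to conversion. *)
rewrite /reduced_minimum_attaining /reduced_min_modulus.
by rewrite trivial_null_space_carrier.
Qed.
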